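(* For any $\rho\in\mathbb{R}$ and $\tau>0$, and for any Dirichlet polynomial $f(s)=\sum_{n=1}^\infty f_n n^{-s}$ (with complex coefficients $f_n$, only finitely many of which are non-zero), we have $$\frac{\tau}{2\pi}\int_{-\infty}^{\infty}\left|f\left(\tfrac{\rho}{2}+it\right)\left(it-\tfrac{\tau}{2}\right)^{-1}\right|^2dt=\sum_{n,m=1}^\infty f_n\overline{f_m}\,[B(\tau,\rho)]_{n,m}.$$
   Context: For real $\tau,\rho$, $B(\tau,\rho)$ is the semi-infinite matrix indexed by $n,m\in\{1,2,3,\dots\}$ with entries $$[B(\tau,\rho)]_{n,m}=\frac{(nm)^{\tau/2}}{(n\vee m)^{\tau}}\,\frac{1}{(nm)^{\rho/2}},$$ where $n\vee m=\max\{n,m\}$. *)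

(* Defs.v *)
From HB Require Import structures.
From mathcomp Require Export all_boot all_order all_algebra.
From mathcomp Require Export complex.
From mathcomp Require Export all_classical all_reals all_analysis.
Export Order.TTheory GRing.Theory Num.Theory.
Export numFieldNormedType.Exports.
Export ComplexField.

Set Implicit Arguments.
Unset Strict Implicit.
Unset Printing Implicit Defensive.

Local Open Scope classical_set_scope.
Local Open Scope ring_scope.
Local Open Scope complex_scope.

Definition cexp (R : realType) (z : R[i]) : R[i] :=
  (expR (complex.Re z) * cos (complex.Im z)) +i* (expR (complex.Re z) * sin (complex.Im z)).

(* Meaningful only for 0 < n. *)
Definition natpowc (R : realType) (n : nat) (s : R[i]) : R[i] :=
  cexp (s * (ln (n%:R : R))%:C).

(* Coefficients are indexed by the positive integers: [f 0] is ignored. *)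
Definition dirichlet_polynomial (R : realType) (f : nat -> R[i]) : Prop :=
  finite_set [set n | (0 < n)%N /\ f n != 0].

(* [\sum_(n \in A)] is the sum over the nonzero terms, and is 0 by convention
   if there are infinitely many of them; this does not happen when [f]
   satisfies [dirichlet_polynomial]. *)
Definition dirichlet_eval (R : realType) (f : nat -> R[i]) (s : R[i]) : R[i] :=
  \sum_(n \in [set n | (0 < n)%N]) f n * natpowc n (- s).

(* The rows and columns of the matrix are those with 0 < n, 0 < m. *)
Definition Bmx (R : realType) (tau rho : R) (n m : nat) : R :=
  (n * m)%N%:R `^ (tau / 2) / (maxn n m)%:R `^ tau
  * (1 / (n * m)%N%:R `^ (rho / 2)).

(* Main.v *)
Require Import Defs.
From mathcomp Require Import measurable_realfun ring lra.

Set Implicit Arguments.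
Unset Strict Implicit.
Unset Printing Implicit Defensive.
Local Open Scope classical_set_scope.
Local Open Scope ring_scope.
Local Open Scope complex_scope.

(** Put b = tau / 2 and p(t) = 1 / (t^2 + b^2), which is the squared modulus of
    the factor (it - b)^-1. Expanding |f(rho/2 + it)|^2 gives a finite sum over
    n, m of (nm)^(-rho/2) times the real part of
    f_n conj(f_m) e^(- i t (ln n - ln m)), so that everything rests on the
    Fourier transform of p:
      int cos(xt) p(t) dt = (pi / b) e^(- b |x|),   int sin(xt) p(t) dt = 0.
    With x = ln n - ln m the exponential is (min(n,m) / max(n,m))^(tau/2), which
    equals (nm)^(tau/2) / max(n,m)^tau. The sum over n, m is Hermitian, hence
    equal to the sum of its real parts.

    The cosine integral I(x) is computed from a differential equation. Formally
    I'' - b^2 I = - int cos(xt) dt vanishes away from 0, but differentiating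
    I twice under the integral sign destroys integrability. One integrates twice
    instead: let
      J(x) = int (1 - cos(xt)) / t^2 p(t) dt.
    Two differentiations under the integral are legitimate and give J'' = I
    ([is_derive_Ifejer], [is_derive_Isinc]). Since b^2 p(t) / t^2 = 1/t^2 - p(t),
      b^2 J(x) = int (1 - cos(xt)) / t^2 dt - I(0) + I(x),
    and by scaling the first integral is x K for x >= 0, with K its value at 1
    ([Rintegral_fejer]). So on x >= 0 the function I coincides with
    Phi = b^2 J - x K + I(0), which satisfies Phi'' = b^2 I ([Icos_Ifejer]).
    Then e^(-bx) (Phi' + b Phi) is constant on x >= 0, and tends to 0 because I
    is bounded and J' grows at most linearly; hence Phi' = - b Phi, and
    Phi(x) = I(0) e^(-bx) with I(0) = int p = pi / b ([Icos_exp]). *)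

(** * Lebesgue integration on the real line *)

Section lebesgue_complements.
Context {R : realType}.
Notation mu := (@lebesgue_measure R).
Implicit Types (a x t : R) (f : R -> R).

(** The inverse is continuous only away from 0, but a point is measurable. *)
Lemma measurable_inv : measurable_fun [set: R] (fun t => t^-1).
Proof.
have -> : [set: R] = [set 0] `|` ~` [set 0] by rewrite setUv.
apply/measurable_funU => //; first exact: measurableC.
split; first exact: measurable_fun_set1.
apply: open_continuous_measurable_fun.
  by apply: closed_openC; exact: closed_eq.
move=> t /set_mem /= /eqP t0; exact: inv_continuous.
Qed.

(** Up to the factor a, both sides are measures that agree on half-open
    intervals. *)
Lemma lebesgue_measure_scale a (a0 : 0 < a) (A : set R) : measurable A ->
  pushforward mu ( *%R a : _ -> measurableTypeR R) A = ((a^-1)%:E * mu A)%E.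
Proof.
move=> mA.
have a0' : 0 <= a by exact: ltW.
have mpf : measurable_fun [set: measurableTypeR R] ( *%R a : _ -> measurableTypeR R).
  exact: mulrl_measurable.
pose m := mscale (NngNum a0') (pushforward mu ( *%R a : measurableTypeR R -> measurableTypeR R)).
have : mu A = m mpf A.
  apply: lebesgue_measure_unique => // _ [[c d]] _ <-.
  rewrite /m /= /mscale /= /pushforward.
  rewrite (_ : _ @^-1` _ = `]a^-1 * c, a^-1 * d]%classic); last first.
    apply/seteqP; split => x /=; rewrite !in_itv /=;
      by rewrite ltr_pdivrMl// ler_pdivlMl.
  rewrite !lebesgue_measure_itv/= !lte_fin ltr_pM2l ?invr_gt0//.
  case: ifP => _; last by rewrite mule0.
  by rewrite -EFinD -EFinM; congr EFin; field; lra.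
move=> ->; rewrite /m /= /mscale /= muleA -EFinM mulVf ?mul1e//.
by rewrite gt_eqF.
Qed.

Lemma ge0_integral_scale a (f : R -> \bar R) : 0 < a ->
    measurable_fun setT f -> (forall t, 0 <= f t)%E ->
  (\int[mu]_t f (a * t)%R = (a^-1)%:E * \int[mu]_t f t)%E.
Proof.
move=> a0 mf f0.
have ia0 : 0 <= a^-1 by rewrite invr_ge0 ltW.
rewrite -(ge0_integral_mscale mu measurableT (NngNum ia0))//.
have mpf : measurable_fun [set: measurableTypeR R] ( *%R a : _ -> measurableTypeR R).
  exact: mulrl_measurable.
rewrite -(ge0_integral_pushforward mpf mu measurableT mf)//.
by apply: eq_measure_integral => A mA _; exact: lebesgue_measure_scale.
Qed.

Lemma ge0_integral_oppr (f : R -> \bar R) :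
    measurable_fun setT f -> (forall t, 0 <= f t)%E ->
  (\int[mu]_t f (- t)%R = \int[mu]_t f t)%E.
Proof.
move=> mf f0.
have mpf : measurable_fun [set: measurableTypeR R] (-%R : _ -> measurableTypeR R).
  exact: oppr_measurable.
rewrite -(ge0_integral_pushforward mpf mu measurableT mf)//.
by apply: eq_measure_integral => A mA _; exact: lebesgue_measureN.
Qed.

Lemma integralT_oneDsqr : (\int[mu]_t ((1 + t ^+ 2)^-1)%:E = pi%:E)%E.
Proof.
rewrite (@ge0_symfun_integralT R (fun x => (oneDsqr x)^-1)).
- rewrite (_ : [set x | _] = `[0, +oo[%classic); last first.
    by apply/seteqP; split => x/=; rewrite in_itv/= andbT.
  by rewrite integral0y_oneDsqr -EFinM; congr EFin; field.
- by move=> x; rewrite invr_ge0 addr_ge0 ?sqr_ge0.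
- exact: continuous_oneDsqrV.
- by move=> x /=; rewrite /oneDsqr sqrrN.
Qed.

Lemma integrable_le (f g : R -> R) : measurable_fun setT f ->
  (forall t, `|f t| <= g t) -> mu.-integrable setT (EFin \o g) ->
  mu.-integrable setT (EFin \o f).
Proof.
move=> mf fg ig; apply: le_integrable ig => //; first exact/measurable_EFinP.
by move=> t _ /=; rewrite lee_fin (le_trans (fg t))// ler_norm.
Qed.

Lemma integrable_oneDsqrV :
  mu.-integrable setT (EFin \o (fun t => (1 + t ^+ 2)^-1)).
Proof.
have m : measurable_fun setT (EFin \o (fun t : R => (1 + t ^+ 2)^-1)).
  apply/measurable_EFinP; apply: continuous_measurable_fun.
  exact: continuous_oneDsqrV.
apply/integrableP; split => //.
under eq_integral.
  move=> t _; rewrite /= ger0_norm; last by rewrite invr_ge0 addr_ge0 ?sqr_ge0.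
  over.
by rewrite integralT_oneDsqr ltry.
Qed.

Lemma integrable_decay f C : measurable_fun setT f ->
  (forall t, `|f t| * (1 + t ^+ 2) <= C) -> mu.-integrable setT (EFin \o f).
Proof.
move=> mf fC; apply: (@integrable_le _ (fun t => C * (1 + t ^+ 2)^-1)) => //.
  move=> t; rewrite ler_pdivlMr//.
  by rewrite (@lt_le_trans _ _ 1)// lerDl sqr_ge0.
exact: (integrableZl measurableT C integrable_oneDsqrV).
Qed.

Lemma le_norm_Rintegral (f g : R -> R) : measurable_fun setT f ->
  (forall t, `|f t| <= g t) -> mu.-integrable setT (EFin \o g) ->
  `|\int[mu]_t f t| <= \int[mu]_t g t.
Proof.
move=> mf fg ig; have iff := integrable_le mf fg ig.
apply: (le_trans (le_normr_Rintegral measurableT iff)).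
apply: le_Rintegral => //.
exact: integrable_norm.
Qed.

Lemma Rintegral_sum (I : Type) (r : seq I) (F : I -> R -> R) :
  (forall i, mu.-integrable setT (EFin \o F i)) ->
  mu.-integrable setT (EFin \o (fun t => \sum_(i <- r) F i t)) /\
  \int[mu]_t (\sum_(i <- r) F i t) =
  \sum_(i <- r) \int[mu]_t F i t.
Proof.
move=> iF; have iS s :
    mu.-integrable setT (EFin \o (fun t => \sum_(i <- s) F i t)).
  have -> : EFin \o (fun t => \sum_(i <- s) F i t) =
      (fun t => \sum_(i <- s) (F i t)%:E)%E.
    by apply/funext => t; rewrite /= sumEFin.
  by apply: integrable_sum => // i _; exact: iF.
split=> //; elim: r => [|i r IH].
  rewrite big_nil; under eq_Rintegral do rewrite big_nil.
  by rewrite Rintegral_cst// mul0r.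
rewrite big_cons -IH -RintegralD//.
by apply: eq_Rintegral => t _; rewrite big_cons.
Qed.

(** The condition on [x] in the domination is one that bounds linear in
    [`|x|] can use directly; it contains the interval of radius 1 around [a]. *)
Lemma is_derive_Rintegral (f df : R -> R -> R) (G : R -> R) a :
  (forall x, mu.-integrable setT (EFin \o f x)) ->
  (forall x t, is_derive x 1 (f ^~ t) (df x t)) ->
  mu.-integrable setT (EFin \o G) ->
  (forall x t, `|x| <= `|a| + 1 -> `|df x t| <= G t) ->
  is_derive a 1 (fun x => \int[mu]_t f x t) (\int[mu]_t df a t).
Proof.
move=> intf derf intG dfG.
have d1E x t : partial1of2 f x t = df x t.
  by rewrite partial1of2E; exact: derive_val.
have C : h^-1 *: ((\int[mu]_t f (h + a) t) - (\int[mu]_t f a t)) @[h --> 0^']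
    --> \int[mu]_t df a t.
  have -> : \int[mu]_t df a t = \int[mu]_t partial1of2 f a t.
    by apply: eq_Rintegral => t _; rewrite d1E.
  apply: (@cvg_differentiation_under_integral _ _ _ mu f setT measurableT a (a - 1) (a + 1) _ _ _ G) => //.
  - by rewrite /= in_itv/=; lra.
  - by move=> t; apply: le_trans (dfG a t _) => //; rewrite lerDl.
  - move=> x t; rewrite /= in_itv/= => /andP[ax xa] _; rewrite d1E; apply: dfG.
    have := ler_norm a; have := ler_norm (- a); rewrite normrN ler_norml; lra.
have D : derivable (fun x => \int[mu]_t f x t) a 1.
  by apply/cvg_ex; eexists; under eq_fun do rewrite scaler1; exact: C.
apply: DeriveDef => //; apply/cvg_lim => //.
by under eq_fun do rewrite scaler1; exact: C.
Qed.

End lebesgue_complements.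

(** * Elementary real analysis *)

Section real_calculus.
Context {R : realType}.
Implicit Types (x t : R) (f : R -> R).

Lemma is_derive_continuous f (df : R -> R) :
  (forall x, is_derive x 1 f (df x)) -> continuous f.
Proof.
by move=> dfE x; apply/differentiable_continuous/derivable1_diffP; apply: ex_derive.
Qed.

Lemma is_derive_ge0_cst f (df : R -> R) : (forall x, is_derive x 1 f (df x)) ->
  (forall x, 0 < x -> df x = 0) -> forall x, 0 <= x -> f x = f 0.
Proof.
move=> fE df0 x; rewrite le_eqVlt => /predU1P[<-//|x0].
have [|z] := @MVT R f df 0 x x0 (fun z _ => fE z).
  by apply: continuous_subspaceT; exact: is_derive_continuous fE.
rewrite in_itv/= => /andP[z0 _] /eqP; rewrite df0// mul0r subr_eq0.
by move/eqP.
Qed.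

Lemma expR_bounded_lin (b w A : R) : 0 < b -> 0 <= w ->
  (forall x, 0 <= x -> w * expR (b * x) <= A * (1 + x)) -> w = 0.
Proof.
move=> b0; rewrite le_eqVlt => /predU1P[//|w0] h.
(* with B = A (1 + 2 / b), the hypothesis at x = 2 k / b and e^k >= 1 + k force
   w (1 + k) <= B, which fails for k = B / w *)
have A0 : 0 < A by have := h 0 (lexx _); rewrite mulr0 expR0 addr0; lra.
pose B := A * (1 + 2 / b).
have B0 : 0 < B by rewrite mulr_gt0// addr_gt0// divr_gt0.
pose k := B / w.
have k0 : 0 < k by rewrite divr_gt0.
have x0 : 0 <= 2 * k / b by rewrite ltW// divr_gt0// mulr_gt0.
have := h _ x0.
have -> : b * (2 * k / b) = k + k by field; rewrite gt_eqF.
rewrite expRD leNgt => /negP[].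
have e1 := expR_ge1Dx k.
have : (1 + k) * (1 + k) <= expR k * expR k by apply: ler_pM => //; lra.
move=> e2.
apply: (@lt_le_trans _ _ (w * ((1 + k) * (1 + k)))); last by rewrite ler_pM2l.
have wk : w * (1 + k) = w + B by rewrite /k; field; rewrite gt_eqF.
rewrite mulrA wk.
have : A * (1 + 2 * k / b) <= B * (1 + k).
  rewrite /B -(mulrA A) ler_pM2l//.
  have ib : 0 < b^-1 by rewrite invr_gt0.
  nra.
nra.
Qed.

Lemma le_norm_sin x : `|sin x| <= `|x|.
Proof.
have H (y : R) : 0 < y -> `|sin y| <= y.
  move=> y0.
  have [|c _] := @MVT R sin cos 0 y y0 (fun z _ => is_derive_sin z).
    by apply: continuous_subspaceT; exact: continuous_sin.
  rewrite sin0 !subr0 => ->; rewrite normrM (gtr0_norm y0).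
  by rewrite ler_piMl ?cos_max// ltW.
have [x0|x0|->] := ltgtP x 0.
- by rewrite (ltr0_norm x0) -(opprK x) sinN normrN opprK; apply: H; lra.
- by rewrite (gtr0_norm x0); exact: H.
- by rewrite sin0 normr0.
Qed.

Lemma subr1cos_le x : 1 - cos x <= x ^+ 2 / 2.
Proof.
have [y ->] : exists y, x = y *+ 2 by exists (x / 2); rewrite -mulr_natr; field.
have -> : (y *+ 2) ^+ 2 / 2 = y ^+ 2 + y ^+ 2 by rewrite -mulr_natr; field.
rewrite cos_mulr2n cos2sin2.
have : sin y ^+ 2 <= y ^+ 2.
  rewrite -[leLHS]real_normK ?num_real// -[leRHS]real_normK ?num_real//.
  by rewrite ler_pXn2r ?nnegrE// le_norm_sin.
move: (sin y ^+ 2) (y ^+ 2) => s u; rewrite mulr2n; lra.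
Qed.

Lemma le_norm_sin_div x t : `|sin (x * t) / t| <= `|x|.
Proof.
have [->|t0] := eqVneq t 0; first by rewrite invr0 mulr0 normr0.
by rewrite normrM normfV ler_pdivrMr ?normr_gt0// -normrM le_norm_sin.
Qed.

Lemma norm_subr1cos_div_le x t : `|(1 - cos (x * t)) / t ^+ 2| <= x ^+ 2 / 2.
Proof.
have [->|t0] := eqVneq t 0.
  by rewrite expr0n/= invr0 mulr0 normr0 divr_ge0 ?sqr_ge0.
have t20 : 0 < t ^+ 2 by rewrite exprn_even_gt0.
rewrite ger0_norm; last by rewrite divr_ge0 ?(ltW t20)// subr_ge0 cos_le1.
rewrite ler_pdivrMr//; apply: (le_trans (subr1cos_le _)).
by rewrite exprMn mulrAC.
Qed.

(** Holds for t = 0 as well, both sides being 0 there. *)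
Lemma divXX t : t / t ^+ 2 = t^-1.
Proof.
have [->|t0] := eqVneq t 0; first by rewrite invr0 mul0r.
by field.
Qed.

Lemma measurable_cosM x : measurable_fun setT (fun t => cos (x * t)).
Proof.
apply: continuous_measurable_fun => t; apply: continuous_comp.
  exact: mulrl_continuous.
exact: continuous_cos.
Qed.

Lemma measurable_sinM x : measurable_fun setT (fun t => sin (x * t)).
Proof.
apply: continuous_measurable_fun => t; apply: continuous_comp.
  exact: mulrl_continuous.
exact: continuous_sin.
Qed.

End real_calculus.

(** * The kernel (1 - cos(xt)) / t^2 *)

Section fejer_kernel.
Context {R : realType}.
Notation mu := (@lebesgue_measure R).
Implicit Types (x t : R).

(** The Fejer kernel up to normalization; its value at t = 0 is 0 rather than
    the limit x^2 / 2. *)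
Definition fejer x t := (1 - cos (x * t)) / t ^+ 2.

Lemma fejer_ge0 x t : 0 <= fejer x t.
Proof. by rewrite divr_ge0 ?sqr_ge0// subr_ge0 cos_le1. Qed.

Lemma measurable_fejer x : measurable_fun setT (fejer x).
Proof.
apply: measurable_funM; last first.
  by apply: (measurableT_comp measurable_inv) => /=; exact: measurable_funX.
by apply: measurable_funB => //; exact: measurable_cosM.
Qed.

Lemma integrable_fejer x : mu.-integrable setT (EFin \o fejer x).
Proof.
apply: (@integrable_decay _ _ (x ^+ 2 / 2 + 2)); first exact: measurable_fejer.
move=> t; rewrite mulrDr mulr1 lerD ?norm_subr1cos_div_le//.
have [->|t0] := eqVneq t 0; first by rewrite expr0n mulr0.
rewrite ger0_norm ?fejer_ge0// divfK ?expf_neq0//.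
have := cos_geN1 (x * t); lra.
Qed.

(** The substitution u = xt. *)
Lemma Rintegral_fejer x : 0 <= x -> \int[mu]_t fejer x t = x * \int[mu]_t fejer 1 t.
Proof.
rewrite le_eqVlt => /predU1P[<-|x0].
  rewrite mul0r; under eq_Rintegral do rewrite /fejer mul0r cos0 subrr mul0r.
  by rewrite Rintegral_cst// mul0r.
have mfejer1 : measurable_fun setT (EFin \o fejer 1).
  by apply/measurable_EFinP; exact: measurable_fejer.
transitivity (x ^+ 2 * \int[mu]_t fejer 1 (x * t)).
  rewrite -RintegralZl//.
    apply: eq_Rintegral => t _; rewrite /fejer mul1r.
    have [->|t0] := eqVneq t 0; first by rewrite mulr0 expr0n/= invr0 !mulr0.
    by field; rewrite t0 gt_eqF.
  apply: (@integrable_decay _ _ (2 / x ^+ 2 + 1/2)).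
    by apply: (measurableT_comp (measurable_fejer 1)) => /=; exact: mulrl_measurable.
  move=> t; rewrite mulrDr mulr1 addrC lerD//; last first.
    by have := norm_subr1cos_div_le 1 (x * t); rewrite expr1n.
  have [->|t0] := eqVneq t 0; first by rewrite expr0n mulr0 divr_ge0 ?sqr_ge0.
  rewrite ger0_norm ?fejer_ge0// /fejer mul1r.
  have -> : (1 - cos (x * t)) / (x * t) ^+ 2 * t ^+ 2 = (1 - cos (x * t)) / x ^+ 2.
    by field; rewrite t0 gt_eqF.
  rewrite ler_pM2r ?invr_gt0 ?exprn_gt0//.
  have := cos_geN1 (x * t); lra.
rewrite /Rintegral (ge0_integral_scale x0 mfejer1); last first.
  by move=> t; rewrite lee_fin fejer_ge0.
rewrite fineM//=; last exact: integrable_fin_num (integrable_fejer 1).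
by rewrite mulrA; congr (_ * _); field; rewrite gt_eqF.
Qed.

Definition fejer_mass := \int[mu]_t fejer 1 t.

End fejer_kernel.

(** * The Fourier transform of 1 / (t^2 + b^2) *)

Section lorentz_kernel.
Context {R : realType}.
Notation mu := (@lebesgue_measure R).
Implicit Types (x t : R).

Variables (b : R) (b0 : 0 < b).

Definition lorentz t : R := (t ^+ 2 + b ^+ 2)^-1.
Notation p := lorentz.

Lemma lorentz_gt0 t : 0 < p t.
Proof. by rewrite invr_gt0 ltr_wpDl ?sqr_ge0// exprn_gt0. Qed.

Lemma lorentzE t : p t = b^-1 ^+ 2 * (1 + (b^-1 * t) ^+ 2)^-1.
Proof.
have := lorentz_gt0 t; rewrite /lorentz invr_gt0 => h.
by field; rewrite (gt_eqF b0) /= addrC gt_eqF.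
Qed.

Lemma measurable_lorentz : measurable_fun setT p.
Proof.
apply: (measurableT_comp measurable_inv) => /=.
by apply: measurable_funD => //; exact: measurable_funX.
Qed.

Lemma integral_lorentz : (\int[mu]_t (p t)%:E = (pi / b)%:E)%E.
Proof.
have mv : measurable_fun setT (EFin \o (fun t : R => (1 + t ^+ 2)^-1)).
  apply/measurable_EFinP; apply: continuous_measurable_fun.
  exact: continuous_oneDsqrV.
transitivity ((b^-1 ^+ 2)%:E * \int[mu]_t ((1 + (b^-1 * t) ^+ 2)^-1)%:E)%E.
  rewrite -ge0_integralZl//=.
  - by apply: eq_integral => t _; rewrite lorentzE EFinM.
  - apply: (measurableT_comp mv) => /=; exact: mulrl_measurable.
  - by move=> t _; rewrite lee_fin invr_ge0 addr_ge0 ?sqr_ge0.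
  - by rewrite lee_fin sqr_ge0.
rewrite (ge0_integral_scale _ mv) ?invr_gt0//; last first.
  by move=> t; rewrite lee_fin invr_ge0 addr_ge0 ?sqr_ge0.
by rewrite integralT_oneDsqr -!EFinM; congr EFin; field; rewrite gt_eqF.
Qed.

Lemma integrable_lorentz : mu.-integrable setT (EFin \o p).
Proof.
apply/integrableP; split.
  by apply/measurable_EFinP; exact: measurable_lorentz.
under eq_integral do rewrite /= ger0_norm ?(ltW (lorentz_gt0 _))//.
by rewrite integral_lorentz ltry.
Qed.

Lemma Rintegral_lorentz : \int[mu]_t p t = pi / b.
Proof. by rewrite /Rintegral integral_lorentz. Qed.

Lemma integrable_Mlorentz C : mu.-integrable setT (EFin \o (fun t => C * p t)).
Proof. exact: (integrableZl measurableT C integrable_lorentz). Qed.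

(** The integrand of J and its first two derivatives in x. As all three are 0
    at t = 0, the derivatives are exact for every t; this is what the factor
    t / t in the last one, equal to 1 for t != 0, is for. *)
Definition fejer_lorentz x t := (1 - cos (x * t)) / t ^+ 2 * p t.
Definition sinc_lorentz x t := sin (x * t) / t * p t.
Definition dsinc_lorentz x t := cos (x * t) * (t / t) * p t.

Lemma measurable_fejer_lorentz x : measurable_fun setT (fejer_lorentz x).
Proof.
apply: measurable_funM; [exact: measurable_fejer|exact: measurable_lorentz].
Qed.

Lemma measurable_sinc_lorentz x : measurable_fun setT (sinc_lorentz x).
Proof.
apply: measurable_funM; last exact: measurable_lorentz.
apply: measurable_funM; [exact: measurable_sinM|exact: measurable_inv].
Qed.

Lemma measurable_dsinc_lorentz x : measurable_fun setT (dsinc_lorentz x).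
Proof.
apply: measurable_funM; last exact: measurable_lorentz.
apply: measurable_funM; first exact: measurable_cosM.
by apply: measurable_funM; [exact: measurable_id|exact: measurable_inv].
Qed.

Lemma is_derive_fejer_lorentz x t : is_derive x 1 (fejer_lorentz ^~ t) (sinc_lorentz x t).
Proof.
rewrite /fejer_lorentz /sinc_lorentz; apply: is_derive_eq.
by rewrite /GRing.scale /= -(divXX t); ring.
Qed.

Lemma is_derive_sinc_lorentz x t : is_derive x 1 (sinc_lorentz ^~ t) (dsinc_lorentz x t).
Proof.
rewrite /sinc_lorentz /dsinc_lorentz; apply: is_derive_eq.
by rewrite /GRing.scale /=; ring.
Qed.

Lemma norm_dsinc_lorentz_le x t : `|dsinc_lorentz x t| <= p t.
Proof.
rewrite /dsinc_lorentz normrM (gtr0_norm (lorentz_gt0 _)) ler_piMl ?(ltW (lorentz_gt0 _))//.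
rewrite normrM -[leRHS]mulr1 ler_pM ?cos_max//.
by have [->|t0] := eqVneq t 0; rewrite ?mul0r ?normr0// divff// normr1.
Qed.

Lemma norm_sinc_lorentz_le x t : `|sinc_lorentz x t| <= `|x| * p t.
Proof.
by rewrite normrM (gtr0_norm (lorentz_gt0 _)) ler_pM2r ?lorentz_gt0// le_norm_sin_div.
Qed.

Lemma norm_fejer_lorentz_le x t : `|fejer_lorentz x t| <= x ^+ 2 / 2 * p t.
Proof.
by rewrite normrM (gtr0_norm (lorentz_gt0 _)) ler_pM2r ?lorentz_gt0// norm_subr1cos_div_le.
Qed.

Lemma integrable_dsinc_lorentz x : mu.-integrable setT (EFin \o dsinc_lorentz x).
Proof. exact: integrable_le (measurable_dsinc_lorentz x) (norm_dsinc_lorentz_le x) integrable_lorentz. Qed.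

Lemma integrable_sinc_lorentz x : mu.-integrable setT (EFin \o sinc_lorentz x).
Proof. exact: integrable_le (measurable_sinc_lorentz x) (norm_sinc_lorentz_le x) (integrable_Mlorentz _). Qed.

Lemma integrable_fejer_lorentz x : mu.-integrable setT (EFin \o fejer_lorentz x).
Proof. exact: integrable_le (measurable_fejer_lorentz x) (norm_fejer_lorentz_le x) (integrable_Mlorentz _). Qed.

Definition Icos x := \int[mu]_t dsinc_lorentz x t.
Definition Isinc x := \int[mu]_t sinc_lorentz x t.
Definition Ifejer x := \int[mu]_t fejer_lorentz x t.

#[local] Instance is_derive_Ifejer x : is_derive x 1 Ifejer (Isinc x).
Proof.
apply: (@is_derive_Rintegral _ fejer_lorentz sinc_lorentz (fun t => (`|x| + 1) * p t)).
- exact: integrable_fejer_lorentz.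
- exact: is_derive_fejer_lorentz.
- exact: integrable_Mlorentz.
- move=> y t yx; apply: le_trans (norm_sinc_lorentz_le _ _) _.
  by rewrite ler_pM2r ?lorentz_gt0.
Qed.

#[local] Instance is_derive_Isinc x : is_derive x 1 Isinc (Icos x).
Proof.
apply: (@is_derive_Rintegral _ sinc_lorentz dsinc_lorentz p).
- exact: integrable_sinc_lorentz.
- exact: is_derive_sinc_lorentz.
- exact: integrable_lorentz.
- by move=> y t _; exact: norm_dsinc_lorentz_le.
Qed.

Lemma norm_Icos_le x : `|Icos x| <= pi / b.
Proof.
rewrite -Rintegral_lorentz; apply: le_norm_Rintegral.
- exact: measurable_dsinc_lorentz.
- exact: norm_dsinc_lorentz_le.
- exact: integrable_lorentz.
Qed.

Lemma norm_Isinc_le x : `|Isinc x| <= `|x| * (pi / b).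
Proof.
rewrite -Rintegral_lorentz -RintegralZl//; last exact: integrable_lorentz.
apply: le_norm_Rintegral.
- exact: measurable_sinc_lorentz.
- exact: norm_sinc_lorentz_le.
- exact: integrable_Mlorentz.
Qed.

Lemma IcosE x : \int[mu]_t (cos (x * t) * p t) = Icos x.
Proof.
(* the integrands differ at t = 0 only *)
rewrite /Icos /Rintegral; congr fine; apply: ae_eq_integral => //.
- apply/measurable_EFinP; apply: measurable_funM; first exact: measurable_cosM.
  exact: measurable_lorentz.
- by apply/measurable_EFinP; exact: measurable_dsinc_lorentz.
exists [set 0]; split => //; first exact: lebesgue_measure_set1.
move=> t /= tN; apply: contrapT => /eqP t0; apply: tN => _.
by rewrite /dsinc_lorentz divff// mulr1.
Qed.

Lemma Icos0 : Icos 0 = pi / b.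
Proof.
rewrite -IcosE -Rintegral_lorentz; apply: eq_Rintegral => t _.
by rewrite mul0r cos0 mul1r.
Qed.

(** Partial fractions: b^2 / (t^2 (t^2 + b^2)) = 1 / t^2 - 1 / (t^2 + b^2). *)
Lemma fejer_lorentzE x t :
  b ^+ 2 * fejer_lorentz x t = fejer x t - dsinc_lorentz 0 t + dsinc_lorentz x t.
Proof.
rewrite /fejer_lorentz /dsinc_lorentz /fejer mul0r cos0 mul1r.
have [->|t0] := eqVneq t 0; first by rewrite expr0n/= !(invr0,mulr0,mul0r) subrr addr0.
have := lorentz_gt0 t; rewrite /lorentz invr_gt0 => h.
by field; rewrite t0 andbT gt_eqF.
Qed.

(** Solved for [Icos], this says that [Icos] is twice differentiable on the
    half-line, although its integrand cannot be differentiated twice under the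
    integral sign. *)
Lemma Icos_Ifejer x : 0 <= x ->
  Icos x = b ^+ 2 * Ifejer x - x * fejer_mass + Icos 0.
Proof.
move=> x0; rewrite /fejer_mass -Rintegral_fejer// /Ifejer -RintegralZl//; last exact: integrable_fejer_lorentz.
under [in X in _ = X - _ + _]eq_Rintegral do rewrite fejer_lorentzE.
rewrite RintegralD ?RintegralB//.
- by rewrite /Icos; ring.
- exact: integrable_fejer.
- exact: integrable_dsinc_lorentz.
- by have := integrableB measurableT (integrable_fejer x) (integrable_dsinc_lorentz 0); exact.
- exact: integrable_dsinc_lorentz.
Qed.

(** The equation I'' = b^2 I is split into two first-order equations: first
    Phi' + b Phi is a multiple of e^(bx), and this multiple is 0 because
    Phi' + b Phi grows at most linearly; then Phi' = - b Phi. *)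
Lemma Icos_exp x : 0 <= x -> Icos x = pi / b * expR (- (b * x)).
Proof.
pose Phi (x : R) := b ^+ 2 * Ifejer x - x * fejer_mass + Icos 0.
pose Phi' (x : R) := b ^+ 2 * Isinc x - fejer_mass.
have dPhi (y : R) : is_derive y 1 Phi (Phi' y).
  by rewrite /Phi; apply: is_derive_eq; rewrite /GRing.scale /= /Phi'; ring.
have dPhi' (y : R) : is_derive y 1 Phi' (b ^+ 2 * Icos y).
  by rewrite /Phi'; apply: is_derive_eq; rewrite /GRing.scale /=; ring.
have PhiE (y : R) : 0 <= y -> Phi y = Icos y by move=> y0; rewrite Icos_Ifejer.
pose W (x : R) := expR (- (b * x)) * (Phi' x + b * Phi x).
have dW (y : R) : is_derive y 1 W (b ^+ 2 * expR (- (b * y)) * (Icos y - Phi y)).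
  rewrite /W; apply: is_derive_eq; rewrite /GRing.scale /=; ring.
have Wc (y : R) : 0 <= y -> W y = W 0.
  by apply: (is_derive_ge0_cst dW) => z z0; rewrite PhiE ?ltW// subrr mulr0.
have W0 : W 0 = 0.
  apply/eqP; rewrite -normr_eq0; apply/eqP.
  pose P := pi / b.
  have P0 : 0 < P by rewrite divr_gt0// pi_gt0.
  apply: (@expR_bounded_lin _ b _ (b ^+ 2 * P + `|fejer_mass| + b * P)) => // y y0.
  rewrite -(Wc y y0) /W normrM (gtr0_norm (expR_gt0 _)).
  rewrite mulrAC -expRD addNr expR0 mul1r.
  have h1 : `|Phi' y| <= b ^+ 2 * P * y + `|fejer_mass|.
    apply: (le_trans (ler_normB _ _)); rewrite lerD2r normrM ger0_norm ?sqr_ge0//.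
    rewrite -mulrA ler_pM2l ?exprn_gt0// mulrC.
    by rewrite -{2}(ger0_norm y0); exact: norm_Isinc_le.
  have h2 : `|b * Phi y| <= b * P.
    by rewrite normrM (gtr0_norm b0) ler_pM2l// PhiE//; exact: norm_Icos_le.
  apply: (le_trans (ler_normD _ _)).
  have bP0 : 0 <= b * P by rewrite mulr_ge0// ltW.
  have := mulr_ge0 (normr_ge0 fejer_mass) y0; have := mulr_ge0 bP0 y0.
  have : 0 <= b ^+ 2 * P by rewrite mulr_ge0 ?sqr_ge0// ltW.
  move: (b ^+ 2 * P) (b * P) `|fejer_mass| bP0 h1 h2 => u v d bP0 h1 h2; lra.
have Phi'E (y : R) : 0 <= y -> Phi' y = - (b * Phi y).
  move=> y0; have := Wc y y0; rewrite W0 => /eqP.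
  by rewrite mulf_eq0 gt_eqF ?expR_gt0//= addr_eq0 => /eqP.
pose V (x : R) := expR (b * x) * Phi x.
have dV (y : R) : is_derive y 1 V (expR (b * y) * (Phi' y + b * Phi y)).
  by rewrite /V; apply: is_derive_eq; rewrite /GRing.scale /=; ring.
move=> x0.
have : V x = V 0.
  by apply: (is_derive_ge0_cst dV) => // z z0; rewrite Phi'E ?ltW// addNr mulr0.
rewrite /V !PhiE// mulr0 expR0 mul1r => Vx.
have -> : Icos x = expR (- (b * x)) * Icos 0.
  by rewrite -Vx mulrA -expRD addNr expR0 mul1r.
by rewrite Icos0 mulrC.
Qed.

Lemma Rintegral_cos_lorentz x :
  \int[mu]_t (cos (x * t) * p t) = pi / b * expR (- (b * `|x|)).
Proof.
rewrite -Icos_exp// -IcosE; apply: eq_Rintegral => t _; congr (_ * _).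
by have [x0|x0] := ger0P x; rewrite // mulNr cosN.
Qed.

Lemma integrable_cos_lorentz x :
  mu.-integrable setT (EFin \o (fun t => cos (x * t) * p t)).
Proof.
apply: (integrable_le _ _ integrable_lorentz).
  apply: measurable_funM; [exact: measurable_cosM|exact: measurable_lorentz].
move=> t; rewrite normrM (gtr0_norm (lorentz_gt0 _)) ler_piMl ?cos_max//.
exact/ltW/lorentz_gt0.
Qed.

Lemma integrable_sin_lorentz x :
  mu.-integrable setT (EFin \o (fun t => sin (x * t) * p t)).
Proof.
apply: (integrable_le _ _ integrable_lorentz).
  apply: measurable_funM; [exact: measurable_sinM|exact: measurable_lorentz].
move=> t; rewrite normrM (gtr0_norm (lorentz_gt0 _)) ler_piMl ?sin_max//.
exact/ltW/lorentz_gt0.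
Qed.

(** The integrand is odd. The change of variable is made on the non-negative
    function (1 + sin(xt)) p(t). *)
Lemma Rintegral_sin_lorentz x : \int[mu]_t (sin (x * t) * p t) = 0.
Proof.
have ic := integrable_lorentz; have ish := integrable_sin_lorentz x.
have mf : measurable_fun setT (EFin \o (fun t => p t + sin (x * t) * p t)).
  apply/measurable_EFinP; apply: measurable_funD; first exact: measurable_lorentz.
  apply: measurable_funM; [exact: measurable_sinM|exact: measurable_lorentz].
have f0 t : (0 <= (p t + sin (x * t) * p t)%R%:E)%E.
  have -> : p t + sin (x * t) * p t = (1 + sin (x * t)) * p t by ring.
  rewrite lee_fin; apply: mulr_ge0; last exact/ltW/lorentz_gt0.
  by rewrite -lerBlDl sub0r sin_geN1.
have := ge0_integral_oppr mf f0; move=> /(congr1 fine).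
rewrite -[LHS]/(\int[mu]_t (p (- t) + sin (x * (- t)) * p (- t))).
rewrite -[RHS]/(\int[mu]_t (p t + sin (x * t) * p t)).
under [LHS]eq_Rintegral do rewrite mulrN sinN mulNr {1 2}/lorentz sqrrN -/(p _).
by rewrite RintegralB// RintegralD//; lra.
Qed.

End lorentz_kernel.

(** * Finite sums of complex numbers, and the entries of the matrix *)

Section complex_sums.
Context {R : realType}.
Implicit Types (z : R[i]).

Lemma Re_sum (I : Type) (r : seq I) (P : pred I) (F : I -> R[i]) :
  complex.Re (\sum_(i <- r | P i) F i) = \sum_(i <- r | P i) complex.Re (F i).
Proof. by apply: (big_morph (@complex.Re R)) => // -[? ?] [? ?]. Qed.

Lemma normc_sqr z : Normc.normc z ^+ 2 = complex.Re (z * z^*).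
Proof.
case: z => x y /=; rewrite sqr_sqrtr ?addr_ge0 ?sqr_ge0//.
by rewrite mulrN opprK !expr2.
Qed.

Lemma normc_sum_sqr (I : Type) (r : seq I) (F : I -> R[i]) :
  Normc.normc (\sum_(i <- r) F i) ^+ 2 =
  \sum_(i <- r) \sum_(j <- r) complex.Re (F i * (F j)^*).
Proof.
rewrite normc_sqr rmorph_sum mulr_suml Re_sum; apply: eq_bigr => i _.
by rewrite mulr_sumr Re_sum.
Qed.

(** A sum of a Hermitian array is its own conjugate, by exchanging the two
    summations. *)
Lemma hermitian_sum_real (I : Type) (r : seq I) (F : I -> I -> R[i]) :
  (forall i j, F j i = (F i j)^*) ->
  \sum_(i <- r) \sum_(j <- r) F i j =
  (\sum_(i <- r) \sum_(j <- r) complex.Re (F i j))%:C.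
Proof.
move=> FE; set z := LHS.
have zJ : z^* = z.
  rewrite /z rmorph_sum [RHS]exchange_big; apply: eq_bigr => i _ /=.
  by rewrite rmorph_sum; apply: eq_bigr => j _ /=.
have -> : z = (complex.Re z)%:C.
  move: zJ; case: z => x y /= [/eqP]; rewrite eq_sym -subr_eq0 opprK -mulr2n mulrn_eq0/=.
  by move=> /eqP ->.
rewrite /z Re_sum; congr (_ %:C); apply: eq_bigr => i _.
by rewrite Re_sum.
Qed.

Lemma fsbig_widen_seq (A : choiceType) (V : zmodType) (P : set A) (r : seq A)
    (F : A -> V) : uniq r ->
  (forall i, i \in r -> P i) -> (forall i, P i -> i \notin r -> F i = 0) ->
  \sum_(i \in P) F i = \sum_(i <- r) F i.
Proof.
move=> ur rP F0; rewrite [RHS]fsbig_seq//; apply/esym/fsbig_widen.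
  by move=> i /= /rP.
by move=> i [Pi /= /negP]; exact: F0.
Qed.

Lemma normc_pole_sqr (t c : R) : Normc.normc ('i * t%:C - c%:C)^-1 ^+ 2 =
  lorentz c t.
Proof.
rewrite Normc.normcV exprVn; congr (_^-1) => /=.
rewrite sqr_sqrtr ?addr_ge0 ?sqr_ge0//; ring.
Qed.

Lemma natpowcE n (x t : R) : natpowc n (- (x +i* t)) =
  (expR (- (x * ln n%:R)))%:C * (cos (ln n%:R * t) -i* sin (ln n%:R * t)).
Proof.
rewrite /natpowc /cexp /=.
apply/eqP; rewrite eq_complex /=; apply/andP; split; apply/eqP.
all: rewrite !(mulr0, mul0r, subr0, add0r, addr0, mulNr) ?cosN ?sinN ?mulrN (mulrC t) //.
Qed.

Lemma Re_mul_natpowc (z : R[i]) (u v a b t : R) :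
  complex.Re (z * ((u%:C * (cos (a * t) -i* sin (a * t))) *
     (v%:C * (cos (b * t) -i* sin (b * t)))^*)) =
  u * v * (complex.Re z * cos ((a - b) * t) + complex.Im z * sin ((a - b) * t)).
Proof.
case: z => x y /=; rewrite (mulrBl t a b) cosB sinB.
ring.
Qed.

(** For n <= m the last exponent is (tau / 2) (ln n - ln m), that is, the
    exponential is (nm)^(tau/2) / m^tau; both sides are symmetric in n and m. *)
Lemma BmxE (tau rho : R) n m : (0 < n)%N -> (0 < m)%N ->
  Bmx tau rho n m = expR (- (rho / 2 * ln n%:R)) * expR (- (rho / 2 * ln m%:R))
    * expR (- (tau / 2 * `|ln n%:R - ln m%:R|)).
Proof.
have pos (k : nat) : (0 < k)%N -> (0 : R) < k%:R by rewrite ltr0n.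
have key k l : (0 < k)%N -> (k <= l)%N -> Bmx tau rho k l =
   expR (- (rho / 2 * ln k%:R)) * expR (- (rho / 2 * ln l%:R))
    * expR (- (tau / 2 * `|ln k%:R - ln l%:R|)).
  move=> k0 kl; have l0 := leq_trans k0 kl.
  rewrite /Bmx (maxn_idPr kl) /powR !gt_eqF ?pos ?muln_gt0 ?k0//.
  rewrite natrM lnM ?posrE ?pos// ler0_norm; last first.
    by rewrite subr_le0 ler_ln ?posrE ?pos// ler_nat.
  by rewrite mul1r -!expRN -!expRD; congr expR; field.
move=> n0 m0; have [nm|/ltnW mn] := leqP n m; first exact: key.
rewrite distrC [X in X * _]mulrC -key// /Bmx mulnC maxnC //.
Qed.

End complex_sums.

Theorem proposition3p1 (R : realType) (rho tau : R) (htau : 0 < tau)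
    (f : nat -> R[i]) (hf : dirichlet_polynomial f) :
  let g : R -> R := fun t =>
    Normc.normc (dirichlet_eval f ((rho / 2) +i* t)
                 * ('i%C * t%:C - (tau / 2)%:C)^-1) ^+ 2 in
  (@lebesgue_measure R).-integrable setT (EFin \o g) /\
  (tau / (2 * pi) * \int[@lebesgue_measure R]_t g t)%:C
  = \sum_(n \in [set n | (0 < n)%N]) \sum_(m \in [set m | (0 < m)%N])
      f n * (f m)^*%C * (Bmx tau rho n m)%:C.
Proof.
move=> g.
have t20 : 0 < tau / 2 by rewrite divr_gt0.
have [r ur rf] : exists2 r : seq nat, uniq r &
    forall n, n \in r = (0 < n)%N && (f n != 0).
  have [s sE] := (finite_seqP _).1 hf.
  exists (undup s); first exact: undup_uniq.
  move=> n; rewrite mem_undup; apply/idP/idP => [ns|/andP[n0 fn0]].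
    have : [set` s] n by [].
    by rewrite -sE => -[/= -> ->].
  by have : [set n | (0 < n)%N /\ f n != 0] n by []; rewrite sE.
have r0 n : n \in r -> (0 < n)%N by rewrite rf => /andP[].
have f0 n : (0 < n)%N -> n \notin r -> f n = 0.
  by rewrite rf => -> /=; rewrite negbK => /eqP.
have DE t : dirichlet_eval f ((rho / 2) +i* t) =
    \sum_(n <- r) f n * natpowc n (- ((rho / 2) +i* t)).
  by apply: fsbig_widen_seq => // n n0 nr; rewrite f0// mul0r.
pose w n : R := expR (- (rho / 2 * ln n%:R)).
pose l n : R := ln n%:R.
pose K n m t := w n * w m * complex.Re (f n * (f m)^*) * (cos ((l n - l m) * t) * lorentz (tau / 2) t)
  + w n * w m * complex.Im (f n * (f m)^*) * (sin ((l n - l m) * t) * lorentz (tau / 2) t).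
have gE : g = fun t => \sum_(n <- r) \sum_(m <- r) K n m t.
  apply/funext => t; rewrite /g Normc.normcM exprMn normc_pole_sqr DE normc_sum_sqr.
  rewrite mulr_suml; apply: eq_bigr => n _; rewrite mulr_suml; apply: eq_bigr => m _.
  by rewrite rmorphM/= mulrACA !natpowcE Re_mul_natpowc /K /w /l; ring.
have iC n m := integrable_cos_lorentz t20 (l n - l m).
have iS n m := integrable_sin_lorentz t20 (l n - l m).
have iC' n m C := integrableZl measurableT C (iC n m).
have iS' n m C := integrableZl measurableT C (iS n m).
have iK n m : (@lebesgue_measure R).-integrable setT (EFin \o K n m).
  exact: (integrableD measurableT (iC' n m _) (iS' n m _)).
(* the imaginary parts multiply the sine integrals, which vanish *)
have KE n m : \int[@lebesgue_measure R]_t K n m t =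
   w n * w m * complex.Re (f n * (f m)^*) * (pi / (tau / 2) * expR (- (tau / 2 * `|l n - l m|))).
  rewrite RintegralD//; [|exact: iC'|exact: iS'].
  rewrite !RintegralZl// Rintegral_cos_lorentz// Rintegral_sin_lorentz//.
  by rewrite mulr0 addr0.
have iKs n := Rintegral_sum r (iK n).
have [ig Ig] := Rintegral_sum r (fun n => (iKs n).1).
split; first by rewrite gE.
have -> : \sum_(n \in [set n | (0 < n)%N]) \sum_(m \in [set m | (0 < m)%N])
      f n * (f m)^*%C * (Bmx tau rho n m)%:C =
   \sum_(n <- r) \sum_(m <- r) f n * (f m)^*%C * (Bmx tau rho n m)%:C.
  rewrite (fsbig_widen_seq ur r0) => [|n n0 nr]; last first.
    by rewrite fsbig1// => m _; rewrite f0// !mul0r.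
  apply: eq_bigr => n _; apply: fsbig_widen_seq => // m m0 mr.
  by rewrite (f0 m)// conjc0 mulr0 mul0r.
rewrite hermitian_sum_real => [|n m]; last first.
  have conjcM (x y : R[i]) : (x * y)^*%C = x^*%C * y^*%C by exact: rmorphM.
  by rewrite !conjcM conjcK conjc_real [(f n)^* * _]mulrC /Bmx mulnC maxnC.
rewrite gE Ig; congr (_ %:C).
rewrite mulr_sumr; apply: eq_big_seq => n /r0 n0.
rewrite (iKs n).2 mulr_sumr; apply: eq_big_seq => m /r0 m0.
rewrite KE BmxE// -/(w n) -/(w m) -/(l n) -/(l m).
set e := expR _; case: (f n * _) => x y /=.
have pi0 : (pi : R) != 0 by rewrite gt_eqF// pi_gt0.
(* pi enters only as a nonzero number *)
move: (@pi R) pi0 => q q0; by field; rewrite q0 gt_eqF.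
Qed.
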